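(* Let $m,n$ be positive integers and let $A$ be a random real $m\times n$ matrix that is generic with probability one and invariant under reflections. Then for every $\delta\in\{-1,+1\}^m$, $$P\left[\operatorname{colspace}(A)\cap \mathcal{O}_\delta\neq\emptyset\right]=\frac{Q(m,n)}{2^m},\qquad Q(m,n)=2\sum_{k=0}^{n-1}\binom{m-1}{k}.$$ In particular, $A$ admits an arbitrage opportunity with probability $Q(m,n)/2^m$.
   Context: $\operatorname{colspace}(A)\subseteq\mathbb{R}^m$ denotes the column space of $A$. For $\delta=(\delta_1,\ldots,\delta_m)\in\{-1,+1\}^m$, the orthant $\mathcal{O}_\delta$ is $\{x\in\mathbb{R}^m : \delta_i x_i>0,\ i=1,\ldots,m\}$. An $m\times n$ real matrix $A$ admits an arbitrage opportunity if some vector in $\operatorname{colspace}(A)$ has all entries strictly positive. Let $e_1,\ldots,e_m$ be the standard basis of $\mathbb{R}^m$. An $n$-dimensional subspace $\mathcal{V}$ of $\mathbb{R}^m$ is generic if for some (equivalently any) basis $v_1,\ldots,v_n$ of $\mathcal{V}$ and for every choice of $m-n$ distinct standard basis vectors $e_{i_1},\ldots,e_{i_{m-n}}$, the vectors $v_1,\ldots,v_n,e_{i_1},\ldots,e_{i_{m-n}}$ are linearly independent. An $m\times n$ matrix $A$ is generic if $\operatorname{colspace}(A)$ is an $n$-dimensional generic subspace of $\mathbb{R}^m$ (so $n\le m$ and $A$ has rank $n$). A random $m\times n$ matrix is invariant under reflections if its distribution is unchanged when any one of its rows is multiplied by $-1$. *)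

(* Defs.v *)
From HB Require Import structures.
From mathcomp Require Import all_boot all_order all_algebra.
From mathcomp Require Import all_classical all_reals all_analysis.

Set Implicit Arguments.
Unset Strict Implicit.
Unset Printing Implicit Defensive.

Import Order.TTheory GRing.Theory Num.Theory.
Import numFieldNormedType.Exports.

Local Open Scope classical_set_scope.
Local Open Scope ring_scope.

(* m x n real matrices with the Borel sigma-algebra; the ambient space R^m is
   the type 'cV[R]_m of column vectors. *)
Definition borelM (R : realType) (m n : nat) :=
  g_sigma_algebraType (@open 'M[R]_(m, n)).

Definition colspace (R : realType) (m n : nat) (A : 'M[R]_(m, n)) :
    {vspace 'cV[R]_m} :=
  <<[seq col j A | j : 'I_n]>>%VS.

Definition orthant (R : realType) (m : nat) (delta : 'cV[R]_m) :
    set 'cV[R]_m :=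
  [set x | forall i, 0 < delta i 0 * x i 0].

Definition sign_vector (R : realType) (m : nat) (delta : 'cV[R]_m) : Prop :=
  forall i, delta i 0 = -1 \/ delta i 0 = 1.

Definition generic_subspace (R : realType) (m : nat)
    (V : {vspace 'cV[R]_m}) : Prop :=
  exists2 v : seq 'cV[R]_m, basis_of V v &
    forall I : {set 'I_m}, #|I| = (m - \dim V)%N ->
      free (v ++ [seq (delta_mx i 0 : 'cV[R]_m) | i in I]).

Definition generic_matrix (R : realType) (m n : nat) (A : 'M[R]_(m, n)) : Prop :=
  \dim (colspace A) = n /\ generic_subspace (colspace A).

Definition arbitrage (R : realType) (m n : nat) (A : 'M[R]_(m, n)) : Prop :=
  exists2 x : 'cV[R]_m, x \in colspace A & forall i, 0 < x i 0.

Definition reflect_row (R : realType) (m n : nat) (k : 'I_m)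
    (A : 'M[R]_(m, n)) : 'M[R]_(m, n) :=
  \matrix_(i, j) (if i == k then - A i j else A i j).

(* Two distributions are compared on measurable sets only: the value of
   [pushforward P _] on other sets is not meaningful. *)
Definition reflection_invariant (R : realType) (d : measure_display)
    (T : measurableType d) (P : probability T R) (m n : nat)
    (A : {RV P >-> borelM R m n}) : Prop :=
  forall (k : 'I_m) (B : set (borelM R m n)), measurable B ->
    pushforward P (fun w => reflect_row k (A w) : borelM R m n) B =
    distribution P A B.

Definition Qcount (m n : nat) : nat := (2 * \sum_(k < n) 'C(m.-1, k))%N.

(* Main.v *)
(* For a fixed generic matrix, the orthants met by its column space are the
   regions into which R^n is cut by the hyperplanes orthogonal to its rows.
   These hyperplanes are in general position, so adding one of them to the
   others splits exactly the regions of the arrangement induced on it; the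
   resulting Pascal recursion yields Q(m, n) regions (Schlaefli, Cover).
   Reflecting row k exchanges the events attached to two sign vectors that
   differ at k only, so all 2^m events have the same probability, and these
   probabilities sum to the expected number of orthants met, which is
   Q(m, n). *)

Require Import Defs.
From HB Require Import structures.
From mathcomp Require Import all_boot all_order all_algebra.
From mathcomp Require Import all_classical all_reals all_analysis.
From mathcomp Require Import measurable_realfun ring lra zify.

Set Implicit Arguments.
Unset Strict Implicit.
Unset Printing Implicit Defensive.

Import Order.TTheory GRing.Theory Num.Theory.
Import numFieldNormedType.Exports.

Local Open Scope classical_set_scope.
Local Open Scope ring_scope.

(** * Sign patterns and the Pascal recursion for regions *)

Fixpoint sign_patterns (h : nat) : seq bitseq :=
  if h is h'.+1 then
    map (cons true) (sign_patterns h') ++ map (cons false) (sign_patterns h')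
  else [:: [::]].

Lemma size_sign_patterns h : size (sign_patterns h) = (2 ^ h)%N.
Proof. by elim: h => //= h IH; rewrite size_cat !size_map IH expnS; lia. Qed.

Lemma sign_patterns_size h p : p \in sign_patterns h -> size p = h.
Proof.
elim: h p => [|h IH] p /=; first by rewrite inE => /eqP ->.
by rewrite mem_cat => /orP[] /mapP[q /IH <- ->].
Qed.

(* The number of regions of R^d cut out by h central hyperplanes in general
   position; for d = 0 the strict inequalities fail as soon as h > 0. *)
Fixpoint num_regions (h d : nat) : nat :=
  match h, d with
  | 0, _ => 1
  | _.+1, 0 => 0
  | h'.+1, d'.+1 => num_regions h' d'.+1 + num_regions h' d'
  end%N.

(** Induction on [h] with Pascal's rule. At least one hyperplane is assumed, since with none the
    count 1 is odd. *)
Lemma num_regionsE h d : num_regions h.+1 d = (2 * \sum_(k < d) 'C(h, k))%N.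
Proof.
elim: h d => [|h IH] [|d]; rewrite ?big_ord0 //.
  rewrite big_ord_recl big1 //; by case: d.
rewrite -[LHS]/(num_regions h.+1 d.+1 + num_regions h.+1 d)%N !IH -mulnDr.
rewrite !big_ord_recl /= !bin0 -addnA -big_split /=.
by under [in RHS]eq_bigr => i _ do rewrite /bump /= add1n binS.
Qed.

(** * Regions of a central hyperplane arrangement *)

Section Cover.
Variables (R : realFieldType) (n : nat).
Implicit Types (E : 'M[R]_n) (a : 'rV[R]_n) (y z : 'cV[R]_n).
Implicit Types (hs : seq 'rV[R]_n) (p : bitseq).

Definition has_signs hs p y :=
  all2 (fun a (b : bool) => 0 < (-1) ^+ b * (a *m y) 0 0) hs p.

(* [E] matters only through its row space: a square matrix makes it possible to
   impose further equations by [addsmx] without changing the type. *)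
Definition realizes E hs p : Prop :=
  exists2 y, E *m y = 0 & has_signs hs p y.

Lemma has_signsD hs p (s t : R) y z : 0 < s -> 0 < t ->
  has_signs hs p y -> has_signs hs p z -> has_signs hs p (s *: y + t *: z).
Proof.
move=> s0 t0; elim: hs p => [|a hs IH] [|b p] //= /andP[ay hy] /andP[az hz].
apply/andP; split; last exact: IH.
rewrite mulmxDr -!scalemxAr.
rewrite [fun_of_matrix (_ + _) _ _]mxE ![fun_of_matrix (_ *: _) _ _]mxE.
rewrite mulrDr !(mulrCA _ s) !(mulrCA _ t).
by rewrite addr_gt0 // mulr_gt0.
Qed.

(** Finitely many strict inequalities survive a small move along [z]; this allows leaving one
    hyperplane without crossing the others. *)
Lemma has_signs_perturb hs p y z : has_signs hs p y ->
  exists2 e : R, 0 < e &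
    forall t, `|t| <= e -> has_signs hs p (y + t *: z).
Proof.
elim: hs p => [|a hs IH] [|b p] //=; first by exists 1.
case/andP=> ay /IH[e e0 He].
set u := (a *m y) 0 0 in ay; set w := (a *m z) 0 0.
(* The [+ 1] keeps the divisor positive when [w = 0]; the final halving makes the bound on [t * w]
   strict. *)
exists (Num.min e ((-1) ^+ b * u / (`|w| + 1) / 2)) => [|t].
  by rewrite lt_min e0 /= !divr_gt0 // ltr_wpDl.
rewrite le_min => /andP[te tu]; apply/andP; split; last exact: He.
rewrite mulmxDr -scalemxAr [fun_of_matrix (_ + _) _ _]mxE.
rewrite [fun_of_matrix (_ *: _) _ _]mxE -/u -/w mulrDr.
have w1 : 0 < `|w| + 1 by rewrite ltr_wpDl.
have tw : `|t * w| < (-1) ^+ b * u.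
  rewrite normrM; apply: (@le_lt_trans _ _ (`|t| * (`|w| + 1))).
    by rewrite ler_wpM2l // lerDl.
  rewrite -ltr_pdivlMr //; apply: le_lt_trans tu _.
  by rewrite ltr_pdivrMr // ltr_pMr ?divr_gt0 // ltr1n.
have : `|(-1) ^+ b * (t * w)| < (-1) ^+ b * u by rewrite normrMsign.
rewrite ltr_norml => /andP[+ _]; rewrite /u; lra.
Qed.

(** The columns of [cokermx E] are killed by [E], and [a] lies in the row space of [E] iff it kills
    them all. Hence some column pairs nontrivially with [a] and can be rescaled. *)
Lemma exists_outside_direction E a : ~~ (a <= E)%MS ->
  exists2 z : 'cV[R]_n, E *m z = 0 & (a *m z) 0 0 = 1.
Proof.
rewrite submxE; move: (cokermx E) (mulmx_coker E) => K EK.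
case/matrix0Pn=> i [j]; rewrite ord1 => nz.
exists (((a *m K) 0 j)^-1 *: col j K); rewrite -scalemxAr colE mulmxA.
  by rewrite EK mul0mx scaler0.
rewrite -colE [fun_of_matrix (_ *: _) _ _]mxE.
by rewrite [fun_of_matrix (col _ _) _ _]mxE mulVf.
Qed.

Lemma realizes_pos E a hs p (b : bool) y :
  E *m y = 0 -> has_signs hs p y -> 0 < (-1) ^+ b * (a *m y) 0 0 ->
  realizes E (a :: hs) (b :: p).
Proof. by move=> Ey hy ay; exists y => //=; rewrite ay. Qed.

Lemma addsmx_mul_eq0 E a y :
  ((E + <<a>>)%MS *m y == 0) = (E *m y == 0) && (a *m y == 0).
Proof. by rewrite -!sub_kermx addsmx_sub genmxE. Qed.

(** A point on the hyperplane of [a] can be pushed to either side by a small step; conversely, a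
    segment joining the two sides crosses the hyperplane within the same convex cone. *)
Lemma realizes_both E a hs p : ~~ (a <= E)%MS ->
  realizes (E + <<a>>)%MS hs p <->
  realizes E (a :: hs) (true :: p) /\ realizes E (a :: hs) (false :: p).
Proof.
move=> aE; split.
  case=> y /eqP; rewrite addsmx_mul_eq0 => /andP[/eqP Ey /eqP ay] hy.
  have [z Ez az] := exists_outside_direction aE.
  have [e e0 He] := has_signs_perturb z hy.
  split; [apply: (@realizes_pos _ _ _ _ _ (y + (- e) *: z))
         |apply: (@realizes_pos _ _ _ _ _ (y + e *: z))];
    rewrite ?mulmxDr -?scalemxAr ?Ey ?Ez ?scaler0 ?addr0 ?ay ?add0r //;
    try by apply: He; rewrite ?normrN ger0_norm // ltW.
    by rewrite mxE az mulr1 expr1 mulN1r opprK.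
  by rewrite mxE az mulr1 expr0 mul1r.
case=> -[y Ey /= /andP[ay hy]] [z Ez /= /andP[az hz]].
rewrite expr1 mulN1r in ay; rewrite expr0 mul1r in az.
(* Both weights are positive, and [a] kills the combination: up to scaling, it is the crossing point
   of the segment. *)
exists ((a *m z) 0 0 *: y + (- (a *m y) 0 0) *: z); last exact: has_signsD.
apply/eqP; rewrite addsmx_mul_eq0 !mulmxDr -!scalemxAr Ey Ez !scaler0 addr0.
rewrite eqxx /=; apply/eqP/matrixP=> i j; rewrite !ord1 !mxE.
ring.
Qed.

(** Only a point on the hyperplane itself needs care: [realizes_both] moves it off. *)
Lemma realizes_either E a hs p : ~~ (a <= E)%MS ->
  realizes E hs p <->
  realizes E (a :: hs) (true :: p) \/ realizes E (a :: hs) (false :: p).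
Proof.
move=> aE; split; last by case=> -[y Ey /= /andP[_ hy]]; exists y.
case=> y Ey hy; case: (ltgtP ((a *m y) 0 0) 0) => ay.
- by left; apply: realizes_pos Ey hy _; rewrite expr1 mulN1r oppr_gt0.
- by right; apply: realizes_pos Ey hy _; rewrite expr0 mul1r.
left; suff: realizes (E + <<a>>)%MS hs p by case/(realizes_both _ _ aE).
exists y => //; apply/eqP; rewrite addsmx_mul_eq0 Ey eqxx /=.
by apply/eqP/matrixP=> i j; rewrite !ord1 ay mxE.
Qed.

(** Quantifying over subsequences lets the property pass to the tail of [hs], both for the same [E]
    and with the head adjoined to [E]. *)
Definition in_general_position E hs :=
  forall s, subseq s hs -> (\rank E + size s <= n)%N ->
    \rank (E + \sum_(a <- s) <<a>>)%MS = (\rank E + size s)%N.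

Lemma count_realizes E hs d : in_general_position E hs -> (\rank E + d = n)%N ->
  count (fun p => `[< realizes E hs p >]) (sign_patterns (size hs)) =
  num_regions (size hs) d.
Proof.
elim: hs E d => [|a hs IH] E d gp Ed /=.
  rewrite addn0; apply/eqP; rewrite eqb1; apply/asboolP.
  by exists 0; rewrite ?mulmx0.
case: d => [|d] in Ed *.
  (* For [d = 0] the matrix [E] is invertible, so only [y = 0] remains and no strict inequality
     holds. *)
  apply/eqP; rewrite -leqn0 leqNgt -has_count; apply/hasPn => p _.
  apply/asboolPn => -[y Ey].
  have y0 : y = 0.
    have Eu : E \in unitmx.
      by rewrite -row_full_unit /row_full -[X in _ == X]Ed addn0.
    by rewrite -[y](mulKmx Eu) Ey mulmx0.
  by case: p => //= b p; rewrite y0 mulmx0 mxE mulr0 ltxx.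
have rEa : \rank (E + <<a>>)%MS = (\rank E).+1.
  have := gp [:: a]; rewrite big_seq1 sub1seq inE eqxx /= addn1 => -> //; lia.
have aE : ~~ (a <= E)%MS.
  apply/negP=> aE; move: rEa.
  have /addsmx_idPl -> : (<<a>> <= E)%MS by rewrite genmxE.
  by move/n_Sn.
rewrite count_cat !count_map.
(* Inclusion-exclusion over the two signs of [a]: the union counts the regions of the other
   hyperplanes, the intersection those induced on the hyperplane of [a]. *)
rewrite -count_predUI; congr addn.
  rewrite -(IH E d.+1) //.
    apply: eq_count => p /=; rewrite -asbool_or; apply: asbool_equiv_eq.
    by split=> /(realizes_either hs p aE).
  by move=> s shs; apply: gp; apply: subseq_trans shs (subseq_cons _ _).
rewrite -(IH (E + <<a>>)%MS d); last by rewrite rEa; lia.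
  apply: eq_count => p /=; rewrite -asbool_and; apply: asbool_equiv_eq.
  by split=> /(realizes_both hs p aE).
move=> s shs; rewrite rEa => ss; have := gp (a :: s).
rewrite big_cons addsmxA /= eqxx -addSnnS => -> //.
Qed.
End Cover.

(** * Generic matrices have rows in general position *)

Section Generic.
Variables (R : realType) (m n : nat).
Implicit Types M : 'M[R]_(m, n).

Lemma colspaceP M (x : 'cV[R]_m) :
  reflect (exists y, x = M *m y) (x \in colspace M).
Proof.
apply: (iffP idP) => [|[y ->]].
  move=> xM.
  have /memv_imgP[y _ ->] : x \in limg (linfun (mulmx M : 'cV_n -> 'cV_m)).
    apply: subvP x xM.
    apply/span_subvP => _ /mapP[j _ ->].
    by apply/memv_imgP; exists (delta_mx j 0); rewrite ?memvf // lfunE colE.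
  by exists y; rewrite lfunE.
have -> : M *m y = \sum_j y j 0 *: col j M.
  apply/matrixP=> i k; rewrite ord1 mxE summxE; apply: eq_bigr => j _.
  by rewrite !mxE mulrC.
apply: memv_suml => j _; apply: memvZ; apply: memv_span; apply: map_f.
by rewrite mem_enum.
Qed.

Lemma generic_dim_le M : generic_matrix M -> (n <= m)%N.
Proof.
case=> dM _; have := dimvS (subvf (colspace M)).
by rewrite dM dimvf dim_matrix mulr1.
Qed.

(* The covector [c] vanishes on the column space of [M] and on the
   [delta_mx i 0] with [i] in [I]; by genericity these span the whole space. *)
Lemma generic_left_kernel M (c : 'rV[R]_m) (I : {set 'I_m}) :
  generic_matrix M -> #|I| = (m - n)%N -> c *m M = 0 ->
  (forall i, i \in I -> c 0 i = 0) -> c = 0.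
Proof.
move=> gM cI cM c0; have nm := generic_dim_le gM.
case: gM => dM [v bv /(_ I)]; rewrite dM => /(_ cI).
set X := (X in free X) => Xfree.
have sv : size v = n by rewrite -(eqnP (basis_free bv)) (span_basis bv).
have sX : size X = m by rewrite size_cat sv size_image cI subnKC.
have XT : (<<X>> = fullv)%VS.
  apply/eqP; rewrite eqEdim subvf dimvf dim_matrix mulr1.
  by rewrite (eqnP Xfree) sX leqnn.
have : (<<X>> <= lker (linfun (mulmx c : 'cV[R]_m -> 'M[R]_1)))%VS.
  apply/span_subvP => x; rewrite mem_cat memv_ker lfunE /= => /orP[xv|].
    have /colspaceP[y ->] : x \in colspace M.
      by rewrite -(span_basis bv) memv_span.
    by rewrite mulmxA cM mul0mx.
  case/mapP => i; rewrite mem_enum => iI ->; rewrite -colE.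
  by apply/eqP/matrixP=> k l; rewrite !ord1 !mxE c0.
rewrite XT => /subvP ck; apply/matrixP => i j; rewrite ord1 mxE.
have := ck (delta_mx j 0) (memvf _); rewrite memv_ker lfunE /= -colE.
by move/eqP/matrixP/(_ 0 0); rewrite !mxE.
Qed.

(** A linear relation among at most [n] rows is a covector killing [M] with at least [m - n] zero
    coordinates, so [generic_left_kernel] makes it trivial. *)
Lemma generic_rank_rows M (t : seq 'I_m) : generic_matrix M -> uniq t ->
  (size t <= n)%N -> \rank (\sum_(i <- t) <<row i M>>)%MS = size t.
Proof.
move=> gM; have nm := generic_dim_le gM.
elim: t => [|i t IH] /=; first by rewrite big_nil mxrank0.
case/andP=> it ut st; rewrite big_cons.
set S := (\sum_(j <- t) _)%MS.
have rS : \rank S = size t by apply: IH => //; exact: ltnW.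
have iS : ~~ (row i M <= S)%MS.
  apply/negP => iS.
  (* The row space of [W] consists of the covectors supported on [t]; writing row [i] through
     [W *m M] turns the dependence into a covector [c] supported on [i :: t]. *)
  pose W : 'M[R]_m := (\sum_(j <- t) <<delta_mx 0 j : 'rV[R]_m>>)%MS.
  have : (S <= W *m M)%MS.
    rewrite /S /W; elim: (t) => [|j t' IHt]; first by rewrite big_nil sub0mx.
    rewrite !big_cons addsmxMr addsmx_sub.
    rewrite (submx_trans _ (addsmxSl _ _)) ?(submx_trans IHt (addsmxSr _ _)) //.
    by rewrite genmxE rowE submxMr // genmxE.
  move/(submx_trans iS)/submxP => [u iuW].
  pose c : 'rV[R]_m := delta_mx 0 i - u *m W.
  have cM : c *m M = 0 by rewrite mulmxBl -mulmxA -iuW rowE subrr.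
  have Wk k : k \notin t -> (u *m W) 0 k = 0.
    move=> kt; have : W *m delta_mx k 0 = 0 :> 'cV_m.
      apply/eqP; rewrite -sub_kermx /W; elim: (t) kt => [|j t' IHt].
        by rewrite big_nil sub0mx.
      rewrite inE negb_or => /andP[kj /IHt kt']; rewrite big_cons addsmx_sub kt'.
      by rewrite genmxE sub_kermx mul_delta_mx_0 ?eqxx // eq_sym.
    move/(congr1 (mulmx u)); rewrite mulmxA -colE mulmx0.
    by move/matrixP/(_ 0 0); rewrite !mxE.
  have : (m - n <= #|[predC i :: t]|)%N.
    rewrite -(leq_add2l #|i :: t|) cardC card_ord (card_uniqP _) /= ?it //; lia.
  case/card_geqP => s [us ss sub].
  have c0 : c = 0.
    apply: (@generic_left_kernel M c [set k in s]) => //.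
      by rewrite cardsE (card_uniqP us).
    move=> k; rewrite inE => /sub; rewrite !inE negb_or => /andP[ki kt].
    rewrite /c [fun_of_matrix (_ + _) _ _]mxE [fun_of_matrix (- _) _ _]mxE.
    by rewrite Wk // subr0 mxE eqxx (negPf ki).
  have /matrixP/(_ 0 i) := c0.
  rewrite /c [fun_of_matrix (_ + _) _ _]mxE [fun_of_matrix (- _) _ _]mxE.
  by rewrite Wk // !mxE !eqxx subr0 => /eqP; rewrite oner_eq0.
(* Row [i] spans a line not contained in [S], so the intersection is trivial and the ranks add. *)
have := mxrank_sum_cap <<row i M>>%MS S.
rewrite genmxE rS rank_rV.
have -> : row i M != 0 by apply: contraNneq iS => ->; exact: sub0mx.
suff -> : (<<row i M>> :&: S)%MS = 0 by rewrite mxrank0 addn0.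
apply/eqP; apply: contraNT iS; rewrite -mxrank_eq0 => nz.
have sub : (<<row i M>> :&: S <= row i M)%MS
  by apply: submx_trans (capmxSl _ _) _; rewrite genmxE.
have : (row i M <= <<row i M>> :&: S)%MS.
  rewrite -(geq_leqif (mxrank_leqif_sup sub)) rank_rV.
  by apply: leq_trans (leq_b1 _) _; rewrite lt0n.
by move/submx_trans; apply; apply: capmxSr.
Qed.

Definition rows M := [seq row i M | i <- enum 'I_m].

Lemma generic_general_position M : generic_matrix M ->
  in_general_position 0 (rows M).
Proof.
move=> gM s /subseqP[b sb ->]; rewrite -map_mask mxrank0 add0n size_map => st.
rewrite adds0mx_id big_map.
by apply: generic_rank_rows => //; rewrite mask_uniq // enum_uniq.
Qed.

(** A sign vector is encoded by the set of its negative coordinates, so that reflecting a row in [S]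
    amounts to deleting an element. *)
Definition meets_signs (S : {set 'I_m}) M : Prop :=
  exists y : 'cV[R]_n, forall i, 0 < (-1) ^+ (i \in S) * (M *m y) i 0.

Definition pattern_set (p : bitseq) : {set 'I_m} :=
  [set i : 'I_m | nth false p i].

Lemma realizes_meets M p : size p = m ->
  realizes 0 (rows M) p <-> meets_signs (pattern_set p) M.
Proof.
move=> sp.
have sr : size (rows M) = m by rewrite size_map size_enum_ord.
have rowy (y : 'cV[R]_n) i : (row i M *m y) 0 0 = (M *m y) i 0.
  by rewrite -row_mul mxE.
have key y : has_signs (rows M) p y <->
    (forall i, 0 < (-1) ^+ (i \in pattern_set p) * (M *m y) i 0).
  rewrite /has_signs all2E sr sp eqxx /=; split.
    move/(all_nthP (0, false)); rewrite size_zip sr sp minnn => H i.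
    have := H i (ltn_ord i); rewrite nth_zip ?sr ?sp //= inE.
    by rewrite (nth_map i) ?size_enum_ord // nth_ord_enum rowy.
  move=> H; apply/(all_nthP (0, false)); rewrite size_zip sr sp minnn => k km.
  rewrite nth_zip ?sr ?sp //= (nth_map (Ordinal km)) ?size_enum_ord //.
  have := H (Ordinal km); rewrite inE /= -rowy.
  by rewrite -[k in nth _ (enum _) k]/(nat_of_ord (Ordinal km)) nth_ord_enum.
split=> [[y _ /key]|[y /key]]; first by exists y.
by exists y => //; rewrite mul0mx.
Qed.

Lemma count_meets_signs M : generic_matrix M -> (0 < m)%N ->
  count (fun p => `[< meets_signs (pattern_set p) M >]) (sign_patterns m) =
  Qcount m n.
Proof.
move=> gM m0.
have sr : size (rows M) = m by rewrite size_map size_enum_ord.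
have := count_realizes (d := n) (generic_general_position gM).
rewrite mxrank0 sr => /(_ erefl).
rewrite -[in num_regions _ _](prednK m0) num_regionsE -/(Qcount m n) => <-.
apply: eq_in_count => p /sign_patterns_size /realizes_meets pm.
by apply: asbool_equiv_eq; split=> /pm.
Qed.

(** One witness [y] serves all matrices near [M]. Openness is what gives Borel measurability of the
    events. *)
Lemma open_meets_signs S : open [set M | meets_signs S M].
Proof.
rewrite openE => M [y My]; rewrite /interior.
pose pos_row i := [set N : 'M[R]_(m, n) |
  0 < (-1) ^+ (i \in S) * (N *m y) i 0].
have : nbhs M [set N | forall i, pos_row i N].
  apply: (@filter_forall _ _ pos_row _ (nbhs_filter M)) => i.
  apply: cvgr_gt (My i).
  apply: cvgM; first exact: cvg_cst.
  rewrite [X in _ --> X]mxE; under eq_fun do rewrite mxE.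
  apply: (@cvg_big _ _ +%R 0) => // [|j _].
    exact: add_continuous.
  by apply: cvgM; [exact: coord_continuous|exact: cvg_cst].
by apply: filterS => N; exists y.
Qed.
End Generic.

(** * Reflections, orthants and arbitrage in terms of sign sets *)

Section Signs.
Variables (R : realType) (m n : nat).
Implicit Types M : 'M[R]_(m, n).

(** The same [y] serves both sides: coordinate [k] of the image and its prescribed sign change
    together. *)
Lemma meets_signs_reflect (S : {set 'I_m}) k M : k \in S ->
  meets_signs (S :\ k) (reflect_row k M) <-> meets_signs S M.
Proof.
move=> kS; have key (y : 'cV[R]_n) i :
    (-1) ^+ (i \in S :\ k) * (reflect_row k M *m y) i 0 =
    (-1) ^+ (i \in S) * (M *m y) i 0.
  rewrite in_setD1 [in LHS]mxE [in RHS]mxE.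
  case: eqVneq => [->|ik] /=.
    rewrite kS expr0 mul1r expr1 mulN1r -sumrN; apply: eq_bigr => j _.
    by rewrite mxE eqxx mulNr.
  by congr (_ * _); apply: eq_bigr => j _; rewrite mxE (negPf ik).
by split=> -[y H]; exists y => i; [rewrite -key|rewrite key].
Qed.

Lemma meets_orthant M (delta : 'cV[R]_m) : sign_vector delta ->
  ([set x | x \in colspace M] `&` orthant delta !=set0) <->
  meets_signs [set i | delta i 0 == -1]%SET M.
Proof.
move=> sd.
have key i : (-1) ^+ (i \in [set i | delta i 0 == -1]%SET) = delta i 0.
  rewrite inE; case: (sd i) => ->; first by rewrite eqxx.
  by rewrite -subr_eq0 opprK -mulr2n pnatr_eq0 expr0.
split=> [[_ [/= /colspaceP[y ->] Oy]]|[y My]].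
  by exists y => i; rewrite key; exact: Oy.
exists (M *m y); split=> [|i]; first by apply/colspaceP; exists y.
by rewrite -key.
Qed.

Lemma meets_arbitrage M :
  arbitrage M <-> meets_signs (finset.set0 : {set 'I_m}) M.
Proof.
split=> [[_ /colspaceP[y ->] y0]|[y y0]].
  by exists y => i; rewrite finset.in_set0 mul1r.
exists (M *m y) => [|i]; first by apply/colspaceP; exists y.
by have := y0 i; rewrite finset.in_set0 mul1r.
Qed.
End Signs.

(** * Probabilities of the orthant events *)

Section Prob.
Variables (R : realType) (d : measure_display) (T : measurableType d).
Variables (P : probability T R) (m n : nat) (A : {RV P >-> borelM R m n}).

Definition meets_event (S : {set 'I_m}) : set T :=
  [set w | meets_signs S (A w : 'M[R]_(m, n))].

Lemma measurable_meets_signs S :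
  measurable ([set M | meets_signs S M] : set (borelM R m n)).
Proof. by apply: sub_sigma_algebra; exact: open_meets_signs. Qed.

Lemma measurable_meets_event S : measurable (meets_event S).
Proof.
rewrite -[meets_event S]setTI.
exact: (measurable_funP A) measurableT _ (measurable_meets_signs S).
Qed.

(** Reflecting row [k] trades [S] for [S :\ k] at equal probability; induction on the cardinality
    reaches the empty set. *)
Lemma prob_meets_event S : reflection_invariant A ->
  P (meets_event S) = P (meets_event finset.set0).
Proof.
move=> A_refl; have [c] := ubnP #|S|; elim: c S => // c IH S Sc.
have [->//|/set0Pn[k kS]] := eqVneq S finset.set0.
rewrite -(IH (S :\ k)%SET); last by move: Sc; rewrite (cardsD1 k) kS.
have := A_refl k _ (measurable_meets_signs (S :\ k)%SET).
rewrite /distribution /pushforward => <-; congr (P _).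
by apply/seteqP; split=> w /=; move/(meets_signs_reflect _ kS).
Qed.

(** The sum is the integral of the number of patterns met, which is almost everywhere constant by
    [count_meets_signs]. *)
Lemma sum_prob_meets_event : (0 < m)%N ->
  {ae P, forall w, generic_matrix (A w)} ->
  (\sum_(p <- sign_patterns m) P (meets_event (pattern_set m p)) =
   (Qcount m n)%:R%:E)%E.
Proof.
move=> m0 gA.
under eq_bigr => p _.
  rewrite -[meets_event _]setIT -integral_indic //;
    last exact: measurable_meets_event.
  over.
have mI p : measurable_fun setT (\1_(meets_event (pattern_set m p)) : T -> R).
  exact/measurable_indic/measurable_meets_event.
rewrite -ge0_integral_sum //; last by move=> p; apply/measurable_EFinP.
rewrite (ae_eq_integral (cst (Qcount m n)%:R%:E)) //.
- rewrite integral_cst //.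
  by have := probability_setT P => /= ->; rewrite mule1.
- by apply: emeasurable_sum => p; apply/measurable_EFinP.
apply: filterS gA => w gw _.
rewrite sumEFin -(count_meets_signs gw m0) -sum1_count natr_sum.
rewrite [in RHS]big_mkcond /=; congr EFin; apply: eq_bigr => p _; rewrite indicE.
case: asboolP => pw.
  by rewrite mem_set.
by rewrite memNset.
Qed.

Lemma prob_meets_eventE S : (0 < m)%N ->
  {ae P, forall w, generic_matrix (A w)} -> reflection_invariant A ->
  P (meets_event S) = ((Qcount m n)%:R / 2 ^+ m)%:E.
Proof.
move=> m0 gA rA; have := sum_prob_meets_event m0 gA.
under eq_bigr => p _ do rewrite prob_meets_event //.
rewrite prob_meets_event //.
(* Finiteness brings the equation down to the reals, where the factor [2 ^+ m] can be divided
   out. *)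
have Pfin : P (meets_event finset.set0) \is a fin_num.
  by apply: fin_num_measure; exact: measurable_meets_event.
rewrite -(fineK Pfin) sumEFin => -[].
rewrite big_const_seq count_predT iter_addr_0 size_sign_patterns => <-.
by rewrite -[fine _ *+ _]mulr_natr natrX mulfK // expf_neq0 // pnatr_eq0.
Qed.
End Prob.

Theorem theorem19 (R : realType) (d : measure_display) (T : measurableType d)
    (P : probability T R) (m n : nat) (A : {RV P >-> borelM R m n})
    (m_gt0 : (0 < m)%N) (n_gt0 : (0 < n)%N)
    (A_generic : {ae P, forall w, generic_matrix (A w)})
    (A_refl : reflection_invariant A) :
  (forall delta : 'cV[R]_m, sign_vector delta ->
     P [set w | [set x | x \in colspace (A w)] `&` orthant delta !=set0] =
     ((Qcount m n)%:R / 2 ^+ m)%:E) /\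
  P [set w | arbitrage (A w)] = ((Qcount m n)%:R / 2 ^+ m)%:E.
Proof.
split=> [delta sd|].
  pose S := [set i | delta i 0 == -1]%SET.
  rewrite -(prob_meets_eventE S m_gt0 A_generic A_refl).
  by congr (P _); apply/seteqP; split=> w /=; move/(meets_orthant _ sd).
rewrite -(prob_meets_eventE finset.set0 m_gt0 A_generic A_refl).
by congr (P _); apply/seteqP; split=> w /=; move/meets_arbitrage.
Qed.
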